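(* Let $\mathcal A(\Sigma)$ be a rooted cluster algebra with $\Sigma=(X,X_{fr},\widetilde B)$, where $\widetilde B$ is its $n\times(n+m)$ extended exchange matrix ($\#X=n$, $\#\widetilde X=n+m$). Then: (1) The number of pure cluster sub-algebras $\mathcal A(\Sigma_{I_0,\emptyset})$ of $\mathcal A(\Sigma)$, for $I_0\subseteq X$, is $2^n$. (2) The number of rooted cluster subalgebras $\mathcal A(\Sigma_{I_0,I_1})$ of $\mathcal A(\Sigma)$, for $I_0\subseteq X$ and $I_1\subseteq\widetilde X$ with $I_0\cap I_1=\emptyset$ and $b_{xy}=0$ for all $x\in X\setminus(I_0\cup I_1)$, $y\in I_1$, is equal to the number $W$ of zero submatrices of $U\widetilde B$. These zero submatrices include the empty sub-matrices of the form $U\widetilde B_{J_0\times\emptyset}$ with $J_0\subseteq X$ or $U\widetilde B_{\emptyset\times J_1}$ with $J_1\subseteq\widetilde X$, where the numbers of these two forms are respectively $2^n$ and $2^{n+m}$. (3) The number of proper rooted cluster subalgebras $\mathcal A(\Sigma_{I_0,I_1})$ of $\mathcal A(\Sigma)$ such that $I_1\neq\emptyset$, $I_0=X\setminus(I'\cup I_1)$ for some $I'\subseteq X$, and the $I'\times I_1$ sub-matrix of $U\widetilde B$ is zero, is equal to $W-2^n$.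
   Context: **Seeds and cluster algebras.** A seed $\Sigma=(X,X_{fr},\widetilde B)$ consists of disjoint finite sets $X$ (the cluster; its elements are exchangeable variables; $X=\emptyset$ is allowed) and $X_{fr}$ (frozen variables) such that the extended cluster $\widetilde X=X\cup X_{fr}$ is algebraically independent over $\mathbb Q$, together with an integer matrix $\widetilde B=(b_{xy})_{x\in X,y\in\widetilde X}$ whose principal part $(b_{xy})_{x,y\in X}$ is totally sign-skew-symmetric: every matrix obtained from it by finitely many mutations is sign-skew-symmetric (for all $x,y$, either $b_{xy}=b_{yx}=0$ or $b_{xy}b_{yx}<0$). Mutation of the matrix at $x\in X$ has entries $-b_{yz}$ if $y=x$ or $z=x$, and $b_{yz}+\frac{|b_{yx}|b_{xz}+b_{yx}|b_{xz}|}{2}$ otherwise; mutation of the seed at $x$ also replaces $x$ by $x^{-1}\bigl(\prod_{b_{xt}>0}t^{b_{xt}}+\prod_{b_{xt}<0}t^{-b_{xt}}\bigr)$ and fixes the other variables. The rooted cluster algebra $\mathcal A(\Sigma)$ is the $\mathbb Z[X_{fr}]$-subalgebra of $\mathbb Q(\widetilde X)$ generated by all cluster variables in all seeds obtained from $\Sigma$ by iterated mutations, together with its initial seed $\Sigma$. **Sub-seeds.** For $I_0\subseteq X$, $I_1\subseteq\widetilde X$, $I_0\cap I_1=\emptyset$, $\Sigma_{I_0,I_1}=(X\setminus(I_0\cup I_1),(X_{fr}\cup I_0)\setminus I_1,\widetilde B')$, with $\widetilde B'$ the restriction of $\widetilde B$ to rows $X\setminus(I_0\cup I_1)$ and columns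 $\widetilde X\setminus I_1$. $\mathcal A(\Sigma_{I_0,\emptyset})$ is called a pure cluster subalgebra; $\mathcal A(\Sigma_{I_0,I_1})$ is a rooted cluster subalgebra of $\mathcal A(\Sigma)$ when it admits an injective rooted cluster morphism into $\mathcal A(\Sigma)$, where a rooted cluster morphism is a unital ring homomorphism $f:\mathcal A(\Sigma)\to\mathcal A(\Sigma')$ with $f(\widetilde X)\subseteq\widetilde X'\sqcup\mathbb Z$, $f(X)\subseteq X'\sqcup\mathbb Z$, commuting with mutations, i.e. $f(\mu_{y_s}\cdots\mu_{y_1}(y))=\mu_{f(y_s)}\cdots\mu_{f(y_1)}(f(y))$ for all $y\in\widetilde X$ and all sequences $(y_1,\dots,y_s)$ such that each $y_i$ is exchangeable in $\mu_{y_{i-1}}\cdots\mu_{y_1}(\Sigma)$ and each $f(y_i)$ is exchangeable in $\mu_{f(y_{i-1})}\cdots\mu_{f(y_1)}(\Sigma')$ (mutations fix integers). It is proper if it is not isomorphic (via a bijective rooted cluster morphism) to a pure cluster subalgebra. **Counting convention.** The algebras $\mathcal A(\Sigma_{I_0,I_1})$ are counted as rooted cluster algebras indexed by the pairs $(I_0,I_1)$ (not up to isomorphism); submatrices of $U\widetilde B$ are counted as indexed by pairs $(J_0,J_1)$ with $J_0\subseteq X$ (row set) and $J_1\subseteq\widetilde X$ (column set), the submatrix being $U\widetilde B_{J_0\times J_1}$. Submatrices with empty row or column set are regarded as zero matrices. **Diagonal-unitization matrix.** $U\widetilde B=(c_{xy})_{x\in X,y\in\widetilde X}$ with $c_{xy}=b_{xy}$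 for $x\neq y$ and $c_{xx}=1$. *)

(* Defs.v *)
From HB Require Import structures.
From mathcomp Require Import all_boot all_order all_algebra.
From mathcomp Require Import boolp.
From mathcomp Require Import mpoly.

Set Implicit Arguments.
Unset Strict Implicit.
Unset Printing Implicit Defensive.

Import GRing.Theory.
Local Open Scope ring_scope.

(* Variables are named by labels in a finite type [V]; [var] gives the element
   of the ambient field [F] carried by a label, so that X is the family
   [var v], v in [ex], and X_fr the family [var v], v in [fr].  Only the values
   of [var] on [ex :|: fr], and the entries of [bmat] with row in [ex] and
   column in [ex :|: fr], are meaningful: nothing below depends on the others.
   [F] is any field containing Q(X u X_fr); all the subalgebras considered
   lie in the subfield Q(X u X_fr). *)
Record seed (F : fieldType) (V : finType) := Seed {
  ex : {set V};
  fr : {set V};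
  var : V -> F;
  bmat : V -> V -> int
}.

Definition ext (F : fieldType) (V : finType) (S : seed F V) : {set V} :=
  ex S :|: fr S.

(* Since constant polynomials are included, this forces [F] to have
   characteristic 0, where [ratr] is the embedding of Q into [F]. *)
Definition alg_independent (F : fieldType) (V : finType) (A : {set V})
    (v : V -> F) : Prop :=
  forall p : {mpoly rat[#|A|]},
    mmap (ratr : rat -> F) (fun i => v (enum_val i)) p = 0 -> p = 0.

Section MatrixMutation.
Variable V : finType.
Implicit Types (b : V -> V -> int) (x y z : V).

(* The integer division by 2 is exact. *)
Definition mutate_mx b x y z : int :=
  if (y == x) || (z == x) then - b y z
  else b y z + ((`|b y x| * b x z + b y x * `|b x z|) %/ 2)%Z.

Definition sign_skew_symmetric (A : {set V}) b : Prop :=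
  forall x y, x \in A -> y \in A ->
    (b x y = 0 /\ b y x = 0) \/ b x y * b y x < 0.

Definition totally_sign_skew_symmetric (A : {set V}) b : Prop :=
  forall xs : seq V, all (mem A) xs ->
    sign_skew_symmetric A (foldl mutate_mx b xs).

End MatrixMutation.

Section Seeds.
Variables (F : fieldType) (V : finType).
Implicit Types (S : seed F V) (I J : {set V}) (v x y : V) (z : F).

Definition is_seed S : Prop :=
  [/\ [disjoint ex S & fr S],
      alg_independent (ext S) (var S)
    & totally_sign_skew_symmetric (ex S) (bmat S)].

Definition exchange S x : F :=
  (var S x)^-1 *
    (\prod_(t in ext S | 0 < bmat S x t) var S t ^+ `|bmat S x t|%N
     + \prod_(t in ext S | bmat S x t < 0) var S t ^+ `|bmat S x t|%N).

Definition mutate S x : seed F V :=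
  Seed (ex S) (fr S) (fun y => if y == x then exchange S x else var S y)
       (mutate_mx (bmat S) x).

Definition mutates S (xs : seq V) : seed F V := foldl mutate S xs.

Definition sub_seed S I0 I1 : seed F V :=
  Seed (ex S :\: (I0 :|: I1)) ((fr S :|: I0) :\: I1) (var S) (bmat S).

(* A subring containing X_fr is the same as a subring which is a
   Z[X_fr]-subalgebra. *)
Definition in_cluster_algebra S z : Prop :=
  forall A : {pred F}, subring_closed A ->
    (forall v, v \in fr S -> var S v \in A) ->
    (forall (xs : seq V) v, all (mem (ex S)) xs -> v \in ex S ->
       var (mutates S xs) v \in A) ->
    z \in A.

Definition cluster_algebra S : {pred F} := fun z => `[< in_cluster_algebra S z >].

Lemma cluster_algebra_subring S : subring_closed (cluster_algebra S).
Proof.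
split.
- by apply/asboolP => A [A1 _ _].
- move=> u w /asboolP Hu /asboolP Hw; apply/asboolP => A sA Af Ac.
  by case: (sA) => _ AB _; apply: AB; [apply: Hu | apply: Hw].
- move=> u w /asboolP Hu /asboolP Hw; apply/asboolP => A sA Af Ac.
  by case: (sA) => _ _ AM; apply: AM; [apply: Hu | apply: Hw].
Qed.

HB.instance Definition _ S :=
  GRing.isSubringClosed.Build F (cluster_algebra S) (@cluster_algebra_subring S).

End Seeds.

(* The rooted cluster algebra of [S]; its initial seed is recorded by the
   parameter [S]. *)
Record rooted_cluster_algebra (F : fieldType) (V : finType) (S : seed F V) :=
  RootedClusterAlgebra {
    rca_val :> F;
    rca_valP : rca_val \in cluster_algebra S
  }.

HB.instance Definition _ (F : fieldType) (V : finType) (S : seed F V) :=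
  [isSub for @rca_val F V S].
HB.instance Definition _ (F : fieldType) (V : finType) (S : seed F V) :=
  [Choice of rooted_cluster_algebra S by <:].
HB.instance Definition _ (F : fieldType) (V : finType) (S : seed F V) :=
  [SubChoice_isSubComNzRing of rooted_cluster_algebra S by <:].

Section ElementMutation.
Variables (F : fieldType) (V : finType).
Implicit Types (S : seed F V) (z y : F).

Definition exchangeable S z : bool := z \in [seq var S v | v in ex S].
Definition extended S z : bool := z \in [seq var S v | v in ext S].

(* Mutation in the direction of an exchangeable variable [z] given as an
   element of [F]: [mutate_at S z] is the new seed, and [mutate_elt S z y] the
   effect on an element [y], which is fixed unless [y] is [z] itself.  In a seed
   the label of [z] is unique.  Both are the identity if [z] is not
   exchangeable, a case excluded by [admissible]. *)
Definition exch_label S z : option V := [pick v in ex S | var S v == z].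

Definition mutate_at S z : seed F V :=
  if exch_label S z is Some v then mutate S v else S.

Definition mutate_elt S z y : F :=
  if exch_label S z is Some v then (if y == z then exchange S v else y) else y.

Fixpoint mutate_elts S (zs : seq F) y : F :=
  if zs is z :: zs' then mutate_elts (mutate_at S z) zs' (mutate_elt S z y)
  else y.

Fixpoint admissible S (zs : seq F) : bool :=
  if zs is z :: zs' then exchangeable S z && admissible (mutate_at S z) zs'
  else true.

End ElementMutation.

Definition is_integer (F : fieldType) (z : F) : Prop := exists k : int, z = k%:~R.

(* In the last clause [y'] is the element mu_{ys}(y) of the cluster algebra. *)
Record rooted_cluster_morphism (F F' : fieldType) (V V' : finType)
    (S : seed F V) (S' : seed F' V')
    (f : {rmorphism rooted_cluster_algebra S -> rooted_cluster_algebra S'}) :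
    Prop := RootedClusterMorphism {
  rcm_extended : forall y : rooted_cluster_algebra S,
    extended S (val y) -> extended S' (val (f y)) \/ is_integer (val (f y));
  rcm_exchangeable : forall y : rooted_cluster_algebra S,
    exchangeable S (val y) ->
    exchangeable S' (val (f y)) \/ is_integer (val (f y));
  rcm_mutation : forall (ys : seq (rooted_cluster_algebra S))
      (y y' : rooted_cluster_algebra S),
    extended S (val y) ->
    admissible S [seq val u | u <- ys] ->
    admissible S' [seq val (f u) | u <- ys] ->
    val y' = mutate_elts S [seq val u | u <- ys] (val y) ->
    val (f y') = mutate_elts S' [seq val (f u) | u <- ys] (val (f y))
}.

Section Subalgebras.
Variables (F : fieldType) (V : finType) (S : seed F V).
Implicit Types (I J : {set V}).

Definition sub_index I0 I1 : bool :=
  [&& I0 \subset ex S, I1 \subset ext S & [disjoint I0 & I1]].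

Definition rooted_cluster_subalgebra I0 I1 : Prop :=
  exists f : {rmorphism rooted_cluster_algebra (sub_seed S I0 I1)
                        -> rooted_cluster_algebra S},
    rooted_cluster_morphism f /\ injective f.

Definition proper_subalgebra I0 I1 : Prop :=
  ~ exists I : {set V}, I \subset ex S /\
    exists f : {rmorphism rooted_cluster_algebra (sub_seed S I0 I1)
                          -> rooted_cluster_algebra (sub_seed S I set0)},
      rooted_cluster_morphism f /\ bijective f.

Definition diag_unit (x y : V) : int := if x == y then 1 else bmat S x y.

Definition zero_submx J0 J1 : bool :=
  [forall x in J0, forall y in J1, diag_unit x y == 0].

Definition zero_submatrices : {set {set V} * {set V}} :=
  [set J : {set V} * {set V} |
    [&& J.1 \subset ex S, J.2 \subset ext S & zero_submx J.1 J.2]].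

End Subalgebras.

(* Main.v *)
Require Import Defs.
From HB Require Import structures.
From mathcomp Require Import all_boot all_order all_algebra.
From mathcomp Require Import boolp.
From mathcomp Require Import mpoly.
From mathcomp Require Import ring.

(* If b_xy = 0 for x in X \ (I_0 u I_1) and y in I_1, these entries stay 0 under
   mutation in directions of X \ (I_0 u I_1), so the sub-seed and the seed mutate
   in the same way and the inclusion is a rooted cluster morphism.  For the
   latter one needs that distinct variables of a mutated seed are distinct
   elements: since mutation of positive rational values is invertible, the
   initial variables can be specialized so that the mutated ones take
   prescribed pairwise distinct positive values.  Freezing variables (I_0) keeps
   the extended cluster while deleting I_1 shrinks it, and a bijective rooted
   cluster morphism cannot enlarge the extended cluster; so every subalgebra
   with nonempty I_1 is proper.  The counts then follow from the bijection
   (I_0, I_1) |-> (X \ (I_0 u I_1), I_1). *)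

Set Implicit Arguments.
Unset Strict Implicit.
Unset Printing Implicit Defensive.

Import Order.TTheory GRing.Theory Num.Theory.

(** * Integer polynomials and algebraic independence *)

Section Independence.
Local Open Scope ring_scope.
Variables (F : fieldType) (V : finType) (A : {set V}).

(** Integer coefficients allow the same polynomial to be evaluated in any field: in [F] at the
    variables and in [rat] at a specialization. *)
Definition evalz (K : fieldType) (v : V -> K) (p : {mpoly int[#|A|]}) : K :=
  mmap (intr : int -> K) (fun i => v (enum_val i)) p.

Lemma evalz0 (K : fieldType) (v : V -> K) : evalz v 0 = 0.
Proof. exact: rmorph0. Qed.

Lemma evalz1 (K : fieldType) (v : V -> K) : evalz v 1 = 1.
Proof. exact: rmorph1. Qed.

Lemma evalzD (K : fieldType) (v : V -> K) : {morph evalz v : p q / p + q}.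
Proof. exact: rmorphD. Qed.

Lemma evalzB (K : fieldType) (v : V -> K) : {morph evalz v : p q / p - q}.
Proof. exact: rmorphB. Qed.

Lemma evalzM (K : fieldType) (v : V -> K) : {morph evalz v : p q / p * q}.
Proof. exact: rmorphM. Qed.

Lemma evalzC (K : fieldType) (v : V -> K) k : evalz v k%:MP = k%:~R.
Proof. exact: mmapC. Qed.

Lemma evalz_var x : x \in A ->
  {p | forall (K : fieldType) (v : V -> K), evalz v p = v x}.
Proof.
move=> Ax; exists 'X_(enum_rank_in Ax x) => K v.
by rewrite /evalz mmapX mmap1U enum_rankK_in.
Qed.

(** Independence is stated over [rat]; the passage from integer to rational coefficients is
    injective and preserves the support, hence the evaluation. *)
Lemma alg_independent_int (v : V -> F) p :
  alg_independent A v -> evalz v p = 0 -> p = 0.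
Proof.
move=> indep p0; have := indep (map_mpoly intr p) _.
set q := map_mpoly _ _ => q0.
have {q0} : q = 0.
  apply: q0; rewrite -[RHS]p0 /evalz /mmap (perm_big (msupp p)) /=; last first.
    apply: uniq_perm => [||m]; rewrite ?msupp_uniq //.
    by rewrite !mcoeff_msupp mcoeff_map_mpoly /= intr_eq0.
  by apply: eq_bigr => m _; rewrite /q mcoeff_map_mpoly /= ratr_int.
move/mpolyP=> q0; apply/mpolyP => m; move: (q0 m).
by rewrite mcoeff_map_mpoly !mcoeff0 -[0]/(0%:~R) => /intr_inj.
Qed.

End Independence.

(** * Subtraction-free mutation and positive values *)

Section Mutations.
Local Open Scope ring_scope.
Variables (F : fieldType) (V : finType).
Implicit Types (S : seed F V) (E I : {set V}) (b : V -> V -> int) (xs : seq V).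

Lemma ex_mutates S xs : ex (mutates S xs) = ex S.
Proof. by elim: xs S => //= x xs IH S; rewrite [LHS](IH (mutate S x)). Qed.

Lemma ext_mutates S xs : ext (mutates S xs) = ext S.
Proof. by elim: xs S => //= x xs IH S; rewrite [LHS](IH (mutate S x)). Qed.

(** The exchange formula uses only 1, sums, products and inverses. Subtraction is left out of the
    closure conditions so that [R] may require positivity. *)
Lemma exchange_rel (K K' : fieldType) (R : K -> K' -> Prop) :
    R 1 1 ->
    (forall a a' c c', R a a' -> R c c' -> R (a + c) (a' + c')) ->
    (forall a a' c c', R a a' -> R c c' -> R (a * c) (a' * c')) ->
    (forall a a', R a a' -> R a^-1 a'^-1) ->
  forall E E' b (v : V -> K) (v' : V -> K') x, x \in E :|: E' ->
    (forall y, y \in E :|: E' -> R (v y) (v' y)) ->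
  R (exchange (Seed E E' v b) x) (exchange (Seed E E' v' b) x).
Proof.
move=> R1 RD RM RV E E' b v v' x Ex Rv.
have RX a a' k : R a a' -> R (a ^+ k) (a' ^+ k).
  by move=> Ra; elim: k => // k; rewrite !exprS; apply: RM.
rewrite /exchange /=; apply: (RM); first by apply/RV/Rv.
by apply: (RD); apply: (big_ind2 R) => // t /andP[Et _]; apply/RX/Rv.
Qed.

Lemma mutates_rel (K K' : fieldType) (R : K -> K' -> Prop) :
    R 1 1 ->
    (forall a a' c c', R a a' -> R c c' -> R (a + c) (a' + c')) ->
    (forall a a' c c', R a a' -> R c c' -> R (a * c) (a' * c')) ->
    (forall a a', R a a' -> R a^-1 a'^-1) ->
  forall E E' b (v : V -> K) (v' : V -> K') xs, all (mem E) xs ->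
    (forall y, y \in E :|: E' -> R (v y) (v' y)) ->
  forall y, y \in E :|: E' ->
  R (var (mutates (Seed E E' v b) xs) y) (var (mutates (Seed E E' v' b) xs) y).
Proof.
move=> R1 RD RM RV E E' b v v' xs.
elim: xs b v v' => [|x xs IH] b v v' /=; first by move=> _.
case/andP=> Ex Exs Rv; apply: IH => // y Ey /=.
case: ifP => _; last exact: Rv.
by apply: exchange_rel => //; rewrite inE Ex.
Qed.

Lemma totally_sign_skew_mutate E b x : x \in E ->
  totally_sign_skew_symmetric E b ->
  totally_sign_skew_symmetric E (mutate_mx b x).
Proof. by move=> Ex tb xs Exs; apply: (tb (x :: xs)); rewrite /= Ex. Qed.

Lemma sign_skew_diag E b x : x \in E -> sign_skew_symmetric E b -> b x x = 0.
Proof.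
move=> Ex /(_ x x Ex Ex) [[]//|].
by rewrite -expr2 ltNge sqr_ge0.
Qed.

Lemma exchange_gt0 (K : realFieldType) (T : seed K V) x :
  (forall y, 0 < var T y) -> 0 < exchange T x.
Proof.
move=> T0; rewrite /exchange mulr_gt0 ?invr_gt0 // addr_gt0 //;
  by apply: prodr_gt0 => t _; rewrite exprn_gt0.
Qed.

(** Mutation at [x] negates row [x], so the two monomials trade places; neither contains [x] because
    [b x x = 0]. Hence their sum is the same in both exchange relations. *)
Lemma mutateK (K : fieldType) E E' b (v : V -> K) x : b x x = 0 -> v x != 0 ->
    exchange (Seed E E' v (mutate_mx b x)) x != 0 ->
  exchange (Seed E E' (var (mutate (Seed E E' v (mutate_mx b x)) x)) b) x = v x.
Proof.
move=> bx0 vx0 ex0; move wE: (var _) => w.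
have wt t : t != x -> w t = v t by rewrite -wE /= => /negPf ->.
have wx : w x = exchange (Seed E E' v (mutate_mx b x)) x by rewrite -wE /= eqxx.
apply: (mulfI ex0); rewrite -{1}wx {1}/exchange [var _ x]/= mulrA mulfV ?wx //.
rewrite mul1r.
rewrite /exchange /= mulrAC mulVf // mul1r addrC; congr (_ + _).
  apply: eq_big => [t|t /andP[_ bt]].
    by rewrite /mutate_mx eqxx oppr_gt0.
  rewrite /mutate_mx eqxx abszN wt //.
  by apply: contraTneq bt => ->; rewrite bx0 ltxx.
apply: eq_big => [t|t /andP[_ bt]].
  by rewrite /mutate_mx eqxx oppr_lt0.
rewrite /mutate_mx eqxx abszN wt //.
by apply: contraTneq bt => ->; rewrite bx0 ltxx.
Qed.

(** Mutations are undone one at a time; positive values stay positive, so no exchange vanishes. *)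
Lemma mutates_positive_surj (K : realFieldType) E E' b xs (w : V -> K) :
    totally_sign_skew_symmetric E b -> all (mem E) xs -> (forall y, 0 < w y) ->
  exists2 v : V -> K, forall y, 0 < v y
    & var (mutates (Seed E E' v b) xs) = w.
Proof.
move=> + + w0; elim: xs b => [|x xs IH] b tb /=; first by exists w.
case/andP=> Ex Exs.
have [v v0 vw] := IH _ (totally_sign_skew_mutate Ex tb) Exs.
have e0 : 0 < exchange (Seed E E' v (mutate_mx b x)) x by apply: exchange_gt0.
(* The values [v] suit the remaining mutations; they are pulled back through the first one by
   exchanging at [x] with [mutate_mx b x]. *)
exists (var (mutate (Seed E E' v (mutate_mx b x)) x)).
  by move=> y /=; case: ifP.
rewrite -[RHS]vw /=; congr (var (mutates (Seed _ _ _ _) xs)).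
apply/funext => y /=; case: eqP => // ->.
by rewrite mutateK ?gt_eqF //; apply: sign_skew_diag (tb [::] isT).
Qed.

End Mutations.

(** * Distinctness of mutated variables *)

Section Injectivity.
Local Open Scope ring_scope.
Variables (F : fieldType) (V : finType).

(* [z] is a rational function in the [v x], regular at the rational point [g],
   where it takes the value [q]. *)
Definition specializes (A : {set V}) (v : V -> F) (g : V -> rat)
    (z : F) (q : rat) : Prop :=
  exists a d : {mpoly int[#|A|]},
    [/\ evalz g d != 0, z * evalz v d = evalz v a & q * evalz g d = evalz g a].

(** After clearing denominators, equality of two mutated variables is a polynomial identity in
    independent variables; it then holds at [g] too, where distinct labels have distinct values. *)
Lemma mutates_inj (S : seed F V) (xs : seq V) :
  is_seed S -> all (mem (ex S)) xs ->
  {in ext S &, injective (var (mutates S xs))}.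
Proof.
case: S => E E' v b [_ /= indep tb] Exs x y Ex Ey /= xy.
rewrite /ext /= in indep Ex Ey *; set A := E :|: E' in indep Ex Ey *.
(* The rank separates labels; the successor makes the value of the first label positive. *)
pose w (t : V) : rat := (enum_rank t).+1%:R.
have w0 t : 0 < w t by rewrite ltr0n.
have [g g0 gw] := mutates_positive_surj E' tb Exs w0.
(* Positivity is carried along so that inverses remain regular at [g]. *)
pose R z (q : rat) := 0 < q /\ specializes A v g z q.
have nz (a : {mpoly int[#|A|]}) : evalz g a != 0 -> evalz v a != 0.
  by apply: contraNneq => e; rewrite (alg_independent_int indep e) evalz0.
have Rv t : t \in A -> R (var (mutates (Seed E E' v b) xs) t) (w t).
  move=> At; rewrite -gw; apply: mutates_rel At => //.
  - by split=> //; exists 1, 1; rewrite !evalz1 !mulr1 oner_neq0.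
  - move=> z q z' q' [q0 [a [d [d0 za qa]]]] [q'0 [a' [d' [d'0 za' qa']]]].
    split; first exact: addr_gt0.
    exists (a * d' + a' * d), (d * d'); rewrite !evalzD !evalzM mulf_neq0 //.
    by rewrite -za -za' -qa -qa'; split=> //; ring.
  - move=> z q z' q' [q0 [a [d [d0 za qa]]]] [q'0 [a' [d' [d'0 za' qa']]]].
    split; first exact: mulr_gt0.
    exists (a * a'), (d * d'); rewrite !evalzM mulf_neq0 //.
    by rewrite -za -za' -qa -qa'; split=> //; ring.
  - move=> z q [q0 [a [d [d0 za qa]]]].
    have a0 : evalz g a != 0 by rewrite -qa mulf_neq0 // lt0r_neq0.
    split; first by rewrite invr_gt0.
    exists d, a; split=> //.
      have: evalz v a != 0 by apply: nz.
      by rewrite -za mulf_eq0 negb_or => /andP[z0 _]; rewrite mulKf.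
    by rewrite -qa mulKf ?gt_eqF.
  - move=> u Au; split=> //; have [p pE] := evalz_var Au.
    by exists p, 1; rewrite !evalz1 !mulr1 !pE oner_neq0.
have [[_ [a [d [d0 za qa]]]] [_ [a' [d' [d'0 za' qa']]]]] := (Rv x Ex, Rv y Ey).
have : a * d' - a' * d = 0.
  apply: (alg_independent_int indep).
  by rewrite evalzB !evalzM -za -za' xy; ring.
move/(congr1 (evalz g)); rewrite evalzB !evalzM -qa -qa'.
rewrite evalz0 => /eqP; rewrite subr_eq0 => /eqP e.
have {e} /(mulIf d0)/(mulIf d'0) :
  w x * evalz g d' * evalz g d = w y * evalz g d' * evalz g d.
  by rewrite mulrAC e; ring.
by move/eqP; rewrite eqr_nat eqSS => /eqP/ord_inj/enum_rank_inj.
Qed.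
End Injectivity.

(** * Sub-seeds and the inclusion morphism *)

Section Subalgebra.
Local Open Scope ring_scope.
Variables (F : fieldType) (V : finType).
Implicit Types (S T : seed F V) (I : {set V}).

Lemma mem_cluster_algebra_var S x :
  x \in ext S -> var S x \in cluster_algebra S.
Proof.
rewrite inE => /orP[Sx|Sx]; apply/asboolP => A _ Af Ac; last exact: Af.
exact: (Ac [::]).
Qed.

Lemma ext_sub_seed S I0 I1 : I0 \subset ex S ->
  ext (sub_seed S I0 I1) = ext S :\: I1.
Proof.
move=> /subsetP sI0; apply/setP => x; rewrite !inE.
by move: (sI0 x); case: (x \in I0); case: (x \in ex S); case: (x \in I1);
  case: (x \in fr S) => //= ->.
Qed.

Section Inclusion.
Variables (T S : seed F V).
Hypothesis sTS : {subset cluster_algebra T <= cluster_algebra S}.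

Definition cluster_incl (u : rooted_cluster_algebra T) :
    rooted_cluster_algebra S :=
  RootedClusterAlgebra (sTS (rca_valP u)).

Lemma cluster_incl_zmod_morphism : zmod_morphism cluster_incl.
Proof. by move=> u w; apply: val_inj. Qed.

Lemma cluster_incl_monoid_morphism : monoid_morphism cluster_incl.
Proof. by split=> [|u w]; apply: val_inj. Qed.

HB.instance Definition _ := GRing.isZmodMorphism.Build
  (rooted_cluster_algebra T) (rooted_cluster_algebra S) cluster_incl
  cluster_incl_zmod_morphism.
HB.instance Definition _ := GRing.isMonoidMorphism.Build
  (rooted_cluster_algebra T) (rooted_cluster_algebra S) cluster_incl
  cluster_incl_monoid_morphism.

End Inclusion.

Section SubSeed.
Variables (S : seed F V) (I0 I1 : {set V}).
Hypotheses (S_seed : is_seed S) (sI0 : I0 \subset ex S).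
Hypothesis b0 :
  {in ex S :\: (I0 :|: I1) & I1, forall x y, bmat S x y = 0}.

Let T := sub_seed S I0 I1.

(** A deleted column has entry 0 in row [x], so it enters neither monomial. *)
Lemma exchange_sub_seed (R : seed F V) x :
    I0 \subset ex R -> {in I1, forall y, bmat R x y = 0} ->
  exchange (sub_seed R I0 I1) x = exchange R x.
Proof.
move=> sI0R bR0; rewrite /exchange ext_sub_seed //=.
by congr (_ * (_ + _)); apply: eq_bigl => t; rewrite inE;
   case: (boolP (t \in I1)) => //= /bR0 ->; rewrite ltxx andbF.
Qed.

(** Both claims are proved together: the vanishing entries make the exchanges agree, and they
    persist because each correction term in [mutate_mx] has a factor from row [x] and a column of
    [I1]. *)
Lemma mutates_sub_seed xs : all (mem (ex T)) xs ->
  mutates T xs = sub_seed (mutates S xs) I0 I1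
  /\ {in ex T & I1, forall x y, bmat (mutates S xs) x y = 0}.
Proof.
elim/last_ind: xs => [//|xs x IH]; rewrite all_rcons => /andP[Tx /IH[eqT z]].
rewrite /mutates -!cats1 !foldl_cat -/(mutates T xs) -/(mutates S xs) /=.
rewrite eqT; split; last first.
  move=> u y Tu Iy /=; rewrite /mutate_mx (z u y) // (z x y) //.
  rewrite oppr0 normr0 !mulr0 !addr0.
  by rewrite if_same.
have exE : exchange (sub_seed (mutates S xs) I0 I1) x = exchange (mutates S xs) x.
  by rewrite exchange_sub_seed ?ex_mutates // => y; apply: z.
by rewrite /mutate exE.
Qed.

Lemma cluster_algebra_sub_seed :
  {subset cluster_algebra T <= cluster_algebra S}.
Proof.
move=> z /asboolP; apply; first exact: cluster_algebra_subring.
  move=> x /=; rewrite !inE => /andP[_ Sx].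
  apply: mem_cluster_algebra_var; rewrite inE orbC.
  by case/orP: Sx => [->//|/(subsetP sI0)->]; rewrite orbT.
have sTS : {subset ex T <= ex S} by move=> x; rewrite inE => /andP[].
move=> xs x Txs Tx; rewrite (mutates_sub_seed Txs).1 /=.
apply/asboolP => A _ _; apply; last exact: sTS.
by apply: sub_all Txs => y; apply: sTS.
Qed.

(** The prefix [xs] lets the induction pass through mutated seeds. Labels are recovered from
    elements by [pick], and [mutates_inj] ensures that both seeds mutate at the same label. *)
Lemma mutate_elts_sub_seed xs zs y : all (mem (ex T)) xs ->
    admissible (mutates T xs) zs ->
  mutate_elts (mutates T xs) zs y = mutate_elts (mutates S xs) zs y.
Proof.
elim: zs xs y => //= z zs IH xs y Txs /andP[/imageP[x]].
have exT : ex (mutates T xs) = ex T by apply: ex_mutates.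
rewrite exT => Tx zE.
have sTS : {subset ex T <= ex S} by move=> u; rewrite inE => /andP[].
have Sxs : all (mem (ex S)) xs by apply: sub_all Txs => u; apply: sTS.
have sSe u : u \in ex S -> u \in ext S by rewrite inE => ->.
have inj := mutates_inj S_seed Sxs.
have varT u : var (mutates T xs) u = var (mutates S xs) u.
  by rewrite (mutates_sub_seed Txs).1.
have labT : exch_label (mutates T xs) z = Some x.
  rewrite /exch_label; case: pickP => [u|/(_ x)]; last by rewrite exT Tx zE eqxx.
  rewrite exT !varT zE varT => /andP[Tu /eqP/inj->//]; exact/sSe/sTS.
have labS : exch_label (mutates S xs) z = Some x.
  rewrite /exch_label; case: pickP => [u|/(_ x)]; last first.
    by rewrite ex_mutates sTS // zE varT eqxx.
  rewrite ex_mutates zE varT => /andP[Su /eqP/inj->//]; apply/sSe => //.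
  exact: sTS.
have exE : exchange (mutates T xs) x = exchange (mutates S xs) x.
  have [-> z0] := mutates_sub_seed Txs.
  by rewrite exchange_sub_seed ?ex_mutates // => u; apply: z0.
have mutE R : mutate (mutates R xs) x = mutates R (rcons xs x).
  by rewrite /mutates -cats1 foldl_cat.
rewrite /mutate_at /mutate_elt labT labS exE !mutE.
by apply: IH; rewrite all_rcons /= Txs andbT.
Qed.

Lemma rooted_cluster_subalgebra_sub_seed : rooted_cluster_subalgebra S I0 I1.
Proof.
pose f : {rmorphism _ -> _} := cluster_incl cluster_algebra_sub_seed.
exists f; split; last by move=> u w /(congr1 val) /= /val_inj.
have sTS : {subset ex T <= ex S} by move=> x; rewrite inE => /andP[].
split.
- move=> y /imageP[x Tx yE]; left; apply/imageP; exists x => //.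
  by move: Tx; rewrite ext_sub_seed // inE => /andP[].
- move=> y /imageP[x Tx yE]; left; apply/imageP; exists x => //.
  exact: sTS.
- move=> ys y y' _ adm _ y'E; rewrite [LHS]y'E.
  exact: (mutate_elts_sub_seed (xs := [::])).
Qed.

End SubSeed.

End Subalgebra.

(** * Bijective morphisms and the size of the extended cluster *)

Section CardExt.
Local Open Scope ring_scope.
Variables (F F' : fieldType) (V V' : finType) (S : seed F V) (S' : seed F' V').
Variable f : {rmorphism rooted_cluster_algebra S -> rooted_cluster_algebra S'}.

(* If [#|ext S| < #|ext S'|], some variable x' of [S'] is not the image of a
   variable of [S].  Elements of the algebra of [S] are fractions in [ext S], so
   their images are fractions in variables other than x', and x' itself is not
   such a fraction by algebraic independence. *)
Lemma card_ext_bijective_morphism :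
    alg_independent (ext S') (var S') -> rooted_cluster_morphism f ->
  bijective f -> (#|ext S'| <= #|ext S|)%N.
Proof.
move=> indep fP fbij; rewrite leqNgt; apply/negP => lt_ext.
pose u x : rooted_cluster_algebra S := insubd 0 (var S x).
have uE x : x \in ext S -> val (u x) = var S x.
  by move=> Sx; rewrite /u insubdK //; apply: mem_cluster_algebra_var.
have [x0 _] : exists x0, x0 \in ext S'.
  by apply/set0Pn; rewrite -card_gt0; apply: leq_ltn_trans lt_ext.
(* The label of the image of [x] when that image is a variable; the default [x0] covers integer
   images. *)
pose w x := odflt x0 [pick y in ext S' | var S' y == val (f (u x))].
have [x' S'x' wx'] : exists2 x', x' \in ext S' & x' \notin [set w x | x in ext S].
  apply/subsetPn; apply: contraL lt_ext => /subset_leq_card le1.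
  by rewrite -leqNgt; apply: leq_trans le1 (leq_imset_card _ _).
(* [pt c] moves only the coordinate [x']; [good e] encodes, through evaluations, that [e] is an
   integer polynomial in the other variables. *)
pose pt (c : F') y := if y == x' then c else var S' y.
pose good (e : F') := exists l : {mpoly int[#|ext S'|]},
  evalz (var S') l = e /\ forall c, evalz (pt c) l = e.
have goodC k : good k%:~R by exists k%:MP; split=> [|c]; rewrite evalzC.
have goodB e1 e2 : good e1 -> good e2 -> good (e1 - e2).
  move=> [l1 [h1 h1']] [l2 [h2 h2']]; exists (l1 - l2).
  by split=> [|c]; rewrite evalzB ?h1 ?h2 ?h1' ?h2'.
have goodD e1 e2 : good e1 -> good e2 -> good (e1 + e2).
  move=> [l1 [h1 h1']] [l2 [h2 h2']]; exists (l1 + l2).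
  by split=> [|c]; rewrite evalzD ?h1 ?h2 ?h1' ?h2'.
have goodM e1 e2 : good e1 -> good e2 -> good (e1 * e2).
  move=> [l1 [h1 h1']] [l2 [h2 h2']]; exists (l1 * l2).
  by split=> [|c]; rewrite evalzM ?h1 ?h2 ?h1' ?h2'.
have goodu x : x \in ext S -> good (val (f (u x))).
  move=> Sx; have : extended S (val (u x)).
    by rewrite uE //; apply/imageP; exists x.
  case/(rcm_extended fP) => [/imageP[y S'y fuy]|[k ->]]; last exact: goodC.
  have [wxE wxin] : var S' (w x) = val (f (u x)) /\ w x \in ext S'.
    rewrite /w; case: pickP => [t /andP[S't /eqP]|/(_ y)] //.
    by rewrite S'y fuy eqxx.
  have [p pE] := evalz_var wxin; exists p; rewrite -wxE; split=> [|c].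
    exact: pE.
  rewrite pE /pt; case: eqP => // wxx'.
  by rewrite -wxx' imset_f in wx'.
(* Since [f] is defined on the algebra only, a fraction is kept as a pair of its elements with
   [good] images. *)
pose frac (z : F) := exists a b : rooted_cluster_algebra S,
  [/\ val b != 0, z * val b = val a, good (val (f a)) & good (val (f b))].
have good1 : good (val (f 1)) by rewrite !rmorph1; apply: (goodC 1).
have frac1 : frac 1.
  by exists 1, 1; rewrite rmorph1 mulr1 oner_neq0.
have fracB z1 z2 : frac z1 -> frac z2 -> frac (z1 - z2).
  move=> [a1 [b1 [n1 e1 ga1 gb1]]] [a2 [b2 [n2 e2 ga2 gb2]]].
  exists (a1 * b2 - a2 * b1), (b1 * b2).
  rewrite !(rmorphM, rmorphB) /= mulf_neq0 // -e1 -e2 /=.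
  by split; [| ring | apply: goodB; apply: goodM | apply: goodM].
have fracD z1 z2 : frac z1 -> frac z2 -> frac (z1 + z2).
  move=> [a1 [b1 [n1 e1 ga1 gb1]]] [a2 [b2 [n2 e2 ga2 gb2]]].
  exists (a1 * b2 + a2 * b1), (b1 * b2).
  rewrite !(rmorphM, rmorphD) /= mulf_neq0 // -e1 -e2 /=.
  by split; [| ring | apply: goodD; apply: goodM | apply: goodM].
have fracM z1 z2 : frac z1 -> frac z2 -> frac (z1 * z2).
  move=> [a1 [b1 [n1 e1 ga1 gb1]]] [a2 [b2 [n2 e2 ga2 gb2]]].
  exists (a1 * a2), (b1 * b2).
  rewrite !rmorphM /= mulf_neq0 // -e1 -e2 /=.
  by split; [| ring | apply: goodM | apply: goodM].
have fracV z : frac z -> frac z^-1.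
  (* Here [0^-1 = 0], and 0 is obtained as 1 - 1. *)
  move=> [a [b [n e ga gb]]]; have [->|z0] := eqVneq z 0.
    by rewrite invr0 -(subrr 1); apply: fracB.
  by exists b, a; rewrite -e mulKf // mulf_neq0.
have frac_u x : x \in ext S -> frac (var S x).
  move=> Sx; exists (u x), 1; rewrite rmorph1 mulr1 oner_neq0 uE //.
  by split=> //; apply: goodu.
have frac_all (z : rooted_cluster_algebra S) : frac (val z).
  case: z => z /= /asboolP /(_ (fun z => `[< frac z >])) Sz; apply/asboolP.
  apply: Sz.
  - split=> [|z1 z2 /asboolP h1 /asboolP h2|z1 z2 /asboolP h1 /asboolP h2];
      apply/asboolP => //; [exact: fracB | exact: fracM].
  - by move=> x Sx; apply/asboolP/frac_u; rewrite inE Sx orbT.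
  move=> xs x Sxs Sx; apply/asboolP.
  have Ex : x \in ext S by rewrite inE Sx.
  case: (S) Sxs frac_u Ex => E E' v b /= Sxs fu Ex.
  (* A property is passed to [mutates_rel] as a relation ignoring its second argument. *)
  apply: (@mutates_rel _ F F (fun z _ => frac z) frac1
            (fun a _ c _ => fracD a c) (fun a _ c _ => fracM a c)
            (fun a _ => fracV a) E E' b v v) => //.
have [g gK fK] := fbij.
pose x'' : rooted_cluster_algebra S' := insubd 0 (var S' x').
have x''E : val x'' = var S' x'.
  by rewrite /x'' insubdK //; apply: mem_cluster_algebra_var.
(* The preimage of the variable [x'] is a fraction [a / b], so [x' * f b = f a] with both images
   free of [x']. *)
have [a [b [b0 ab [la [laE laE']] [lb [lbE lbE']]]]] := frac_all (g x'').
have {}ab : g x'' * b = a by apply: val_inj.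
have fb0 : val (f b) != 0.
  apply: contraNneq b0 => fb0.
  have fb : f b = f 0 by apply: val_inj; rewrite !rmorph0.
  by rewrite (bij_inj fbij fb) rmorph0.
have [p pE] := evalz_var S'x'.
have : p * lb - la = 0.
  apply: (alg_independent_int indep).
  by rewrite evalzB evalzM pE lbE laE -ab rmorphM fK rmorphM /= x''E subrr.
move=> l0.
(* The polynomial identity survives any value [c] of [x']; comparing [c = 0] with [c = 1] forces
   [f b = 0]. *)
have e c : c * val (f b) = val (f a).
  apply/eqP; rewrite -subr_eq0 -(lbE' c) -(laE' c).
  have pc : evalz (pt c) p = c by rewrite pE /pt eqxx.
  by rewrite -{1}pc -evalzM -evalzB l0 evalz0.
by move: (e 0) (e 1) fb0; rewrite mul0r mul1r => -> <-; rewrite eqxx.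
Qed.

End CardExt.

(** * Counting zero submatrices *)

Section Counting.
Local Open Scope ring_scope.
Variables (F : fieldType) (V : finType) (S : seed F V).
Implicit Types (I J : {set V}).

(** A pure subalgebra keeps all of [ext S], while deleting a nonempty [I1] loses variables, against
    [card_ext_bijective_morphism]. *)
Lemma proper_subalgebra_deletion I0 I1 : alg_independent (ext S) (var S) ->
  I0 \subset ex S -> I1 \subset ext S -> I1 != set0 -> proper_subalgebra S I0 I1.
Proof.
move=> indep sI0 sI1 I1_n0 [I [sI [f [fP f_bij]]]].
have extI : ext (sub_seed S I set0) = ext S by rewrite ext_sub_seed // setD0.
have := card_ext_bijective_morphism _ fP f_bij; rewrite extI => /(_ indep).
by rewrite ext_sub_seed // leqNgt -[ltnRHS](cardsID I1) (setIidPr sI1)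
  -[ltnLHS]add0n ltn_add2r card_gt0 I1_n0.
Qed.

(** The unit diagonal rules out a label common to rows and columns. *)
Lemma zero_submxP J0 J1 : reflect
  ([disjoint J0 & J1] /\ {in J0 & J1, forall x y, bmat S x y = 0})
  (zero_submx S J0 J1).
Proof.
apply: (iffP forall_inP) => [z|[dJ z] x Jx].
  have zd x y : x \in J0 -> y \in J1 -> diag_unit S x y = 0.
    by move=> Jx Jy; apply/eqP/(forall_inP (z x Jx)).
  split=> [|x y Jx Jy].
    apply/pred0P => x /=; apply/negP => /andP[Jx J'x].
    by have := zd x x Jx J'x; rewrite /diag_unit eqxx.
  by have := zd x y Jx Jy; rewrite /diag_unit; case: (x =P y).
apply/forall_inP => y Jy; rewrite /diag_unit.
case: (x =P y) => [xy|_]; last by rewrite z.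
by have := disjointFr dJ Jx; rewrite xy Jy.
Qed.

(* Exchanges the index [(I0, I1)] of a sub-seed with the index
   [(X \ (I0 u I1), I1)] of a submatrix. *)
Definition compl_index (J : {set V} * {set V}) : {set V} * {set V} :=
  (ex S :\: (J.1 :|: J.2), J.2).

Lemma disjoint_compl_index (J : {set V} * {set V}) :
  [disjoint (compl_index J).1 & (compl_index J).2].
Proof.
rewrite -setI_eq0; apply/eqP/setP => x; rewrite !inE.
by case: (x \in J.2); rewrite ?orbT ?andbF.
Qed.

Lemma compl_indexK (J : {set V} * {set V}) :
  J.1 \subset ex S -> [disjoint J.1 & J.2] -> compl_index (compl_index J) = J.
Proof.
case: J => J0 J1 /= /subsetP sJ dJ; congr (_, _); apply/setP => x.
rewrite !inE; have := disjointFr dJ (x := x); have := sJ x.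
case: (x \in J0) => /= [-> // ->//|_ _].
by case: (x \in ex S); case: (x \in J1).
Qed.

Lemma zero_submatricesP (J : {set V} * {set V}) : reflect
  [/\ J.1 \subset ex S, J.2 \subset ext S, [disjoint J.1 & J.2]
    & {in J.1 & J.2, forall x y, bmat S x y = 0}]
  (J \in zero_submatrices S).
Proof.
rewrite inE; apply: (iffP and3P) => [[? ?] /zero_submxP[? ?] | [? ? ? ?]].
  by split.
by split=> //; apply/zero_submxP.
Qed.

Lemma compl_index_inj : {in zero_submatrices S &, injective compl_index}.
Proof.
apply: can_in_inj (compl_index) _ => J /zero_submatricesP[? _ ? _].
exact: compl_indexK.
Qed.

(** By [compl_indexK] the exchangeable rows of the sub-seed are [J.1], so the zero submatrix
    provides exactly the vanishing that the inclusion requires. *)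
Lemma compl_index_zero_submatrices (J : {set V} * {set V}) :
    is_seed S -> J \in zero_submatrices S ->
  sub_index S (compl_index J).1 (compl_index J).2 /\
  rooted_cluster_subalgebra S (compl_index J).1 (compl_index J).2.
Proof.
move=> S_seed /zero_submatricesP[sJ0 sJ1 dJ z].
split; first by rewrite /sub_index subsetDl sJ1 disjoint_compl_index.
apply: rooted_cluster_subalgebra_sub_seed => //=; first exact: subsetDl.
by have /(congr1 fst)/= -> := compl_indexK sJ0 dJ.
Qed.

Lemma card_zero_submatrices_cols0 :
  #|[set J in zero_submatrices S | J.2 == set0]| = (2 ^ #|ex S|)%N.
Proof.
rewrite -card_powerset -[RHS]muln1 -(cards1 (set0 : {set V})) -cardsX.
apply: eq_card => J; rewrite !inE andbC.
case: eqP => [->|_]; last by rewrite andbF.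
rewrite sub0set andbT /=; case: (_ \subset _) => //=.
by apply/zero_submxP; split=> [|x y]; rewrite ?inE // -setI_eq0 setI0.
Qed.

Lemma card_zero_submatrices_rows0 :
  #|[set J in zero_submatrices S | J.1 == set0]| = (2 ^ #|ext S|)%N.
Proof.
rewrite -card_powerset -[RHS]mul1n -(cards1 (set0 : {set V})) -cardsX.
apply: eq_card => J; rewrite !inE andbC; case: eqP => //= ->.
rewrite sub0set /=; case: (_ \subset _) => //=.
by apply/zero_submxP; split=> [|x y]; rewrite ?inE // -setI_eq0 set0I.
Qed.

End Counting.

Theorem proposition5p1 (F : fieldType) (V : finType) (S : seed F V) (n m : nat)
    (S_seed : is_seed S) (card_ex : #|ex S| = n) (card_ext : #|ext S| = n + m) :
  (* (1) *)
  #|[set I0 : {set V} | (I0 \subset ex S)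
       && `[< rooted_cluster_subalgebra S I0 set0 >]]| = 2 ^ n
  /\
  (* (2) *)
  ( #|[set I : {set V} * {set V} |
        [&& sub_index S I.1 I.2,
            [forall x in ex S :\: (I.1 :|: I.2), forall y in I.2,
               bmat S x y == 0%R]
          & `[< rooted_cluster_subalgebra S I.1 I.2 >]]]|
      = #|zero_submatrices S|
    /\ (forall J0 : {set V}, J0 \subset ex S ->
          (J0, set0) \in zero_submatrices S)
    /\ (forall J1 : {set V}, J1 \subset ext S ->
          (set0, J1) \in zero_submatrices S)
    /\ #|[set J in zero_submatrices S | J.2 == set0]| = 2 ^ n
    /\ #|[set J in zero_submatrices S | J.1 == set0]| = 2 ^ (n + m) )
  /\
  (* (3) *)
  #|[set I : {set V} * {set V} |
      [&& sub_index S I.1 I.2,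
          `[< rooted_cluster_subalgebra S I.1 I.2 >],
          `[< proper_subalgebra S I.1 I.2 >],
          I.2 != set0
        & [exists I' : {set V},
             [&& I' \subset ex S, I.1 == ex S :\: (I' :|: I.2)
               & zero_submx S I' I.2]]]]|
    = #|zero_submatrices S| - 2 ^ n.

Proof.
have sub0 (J0 : {set V}) : J0 \subset ex S -> (J0, set0) \in zero_submatrices S.
  move=> sJ; apply/zero_submatricesP; split=> //=; rewrite ?sub0set //.
    by rewrite -setI_eq0 setI0.
  by move=> x y; rewrite inE.
split; [|split; [split; [|split; [exact: sub0|split; [|split]]]|]].
- rewrite -card_ex -card_powerset; apply: eq_card => I.
  rewrite !inE andb_idr // => sI; apply/asboolP.
  (* Without deleted columns the vanishing condition is vacuous. *)
  by apply: rooted_cluster_subalgebra_sub_seed => // x y _; rewrite in_set0.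
- rewrite -(card_in_imset (@compl_index_inj _ _ S)).
  apply: eq_card => I; rewrite inE; apply/idP/imsetP.
    case/and3P=> /and3P[sI0 sI1 dI] z _.
    exists (compl_index S I); last by rewrite compl_indexK.
    apply/zero_submatricesP; split=> //=; first exact: subsetDl.
      exact: disjoint_compl_index.
    move=> x y Ix Iy; apply/eqP.
    by move/forall_inP: z => /(_ x Ix)/forall_inP; apply.
  case=> J ZJ ->; have [-> rJ] := compl_index_zero_submatrices S_seed ZJ.
  case/zero_submatricesP: ZJ => sJ0 sJ1 dJ z.
  apply/and3P; split=> //; last exact/asboolP.
  apply/forall_inP => x; have /(congr1 fst)/= -> := compl_indexK sJ0 dJ.
  by move=> Jx; apply/forall_inP => y Jy; rewrite z.
- move=> J1 sJ; apply/zero_submatricesP; split=> //=;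
    rewrite ?sub0set -?setI_eq0 ?set0I //.
  by move=> x y; rewrite inE.
- by rewrite card_zero_submatrices_cols0 card_ex.
- by rewrite card_zero_submatrices_rows0 card_ext.
have [_ indep _] := S_seed.
(* The subtracted power counts the zero submatrices without columns; the others, [Z1], correspond
   under [compl_index] to the pairs with nonempty [I.2]. *)
rewrite -card_ex -card_zero_submatrices_cols0.
rewrite -(cardsID [set J | J.2 == set0] (zero_submatrices S)).
set Z0 := zero_submatrices S :&: _.
have -> : [set J in zero_submatrices S | J.2 == set0] = Z0.
  by apply/setP => J; rewrite !inE.
rewrite addKn; set Z1 := _ :\: _.
have sZ1 : {subset Z1 <= zero_submatrices S} by move=> J /setDP[].
have inj1 : {in Z1 &, injective (compl_index S)}.
  by move=> I J /sZ1 ZI /sZ1 ZJ; apply: compl_index_inj.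
rewrite -(card_in_imset inj1); apply: eq_card => I; rewrite inE; apply/idP/imsetP.
  case/and5P=> /and3P[sI0 sI1 dI] _ _ I1_n0 /existsP[I' /and3P[sI' /eqP I0E zI']].
  exists (I', I.2); last by rewrite [I in LHS]surjective_pairing I0E.
  by rewrite !inE /= I1_n0 sI' sI1.
case=> J /setDP[ZJ]; rewrite inE => J1_n0 ->.
have [-> rJ] := compl_index_zero_submatrices S_seed ZJ.
have /zero_submatricesP[sJ0 sJ1 dJ z] := ZJ.
apply/and5P; split=> //; try exact/asboolP.
  by apply/asboolP/proper_subalgebra_deletion => //; apply: subsetDl.
by apply/existsP; exists J.1; rewrite sJ0 eqxx /=; apply/zero_submxP.
Qed.
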